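(* Let $m,l$ be positive integers and $r$ an integer with $0\le r\le m$, $r^l\equiv 1 \pmod m$ and $\gcd(l(r-1),m)=1$, and let $G = \langle a,x \mid a^m = 1 = x^l,\ xax^{-1} = a^r \rangle$ (a $C$-group). Let $N$ be a normal subgroup of $G$. Then one of the following holds. (i) $N \leq \langle a \rangle$. (ii) $N \leq \langle x^k \rangle$, where $k = \mathrm{ord}(r \bmod m)$. (iii) $N = \langle a^{m_1} \rangle \rtimes \langle x^{l_1}\rangle$ for some positive integers $m_1,l_1$ such that $m_1 \mid s$ for some integer $s \equiv r^{l_1} - 1 \pmod m$. Conversely, if a subgroup $N$ of $G$ satisfies one of (i), (ii) or (iii), then $N$ is normal in $G$.
   Context: A $C$-group is a finite group all of whose Sylow subgroups are cyclic; every $C$-group has a presentation of the displayed form, with $G=\langle a\rangle\rtimes\langle x\rangle$, $|\langle a\rangle|=m$, $|\langle x\rangle|=l$. $\mathrm{ord}(r\bmod m)$ denotes the multiplicative order of $r$ modulo $m$ (equal to $1$ when $m=1$). $\langle a^{m_1} \rangle \rtimes \langle x^{l_1}\rangle$ denotes the internal semidirect product, i.e. the subgroup $\langle a^{m_1} \rangle\langle x^{l_1}\rangle$ of $G$. *)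

(* Defs.v *)
From mathcomp Require Export all_boot all_order all_algebra all_fingroup.

Set Implicit Arguments.
Unset Strict Implicit.
Unset Printing Implicit Defensive.

Local Open Scope group_scope.

Definition Cgroup_rels (m l r : nat) (T : groupType) (a x : T) : Prop :=
  [/\ a ^+ m = 1, x ^+ l = 1 & x * a * x^-1 = a ^+ r].

(* G = < a, x | a^m = 1 = x^l, x a x^-1 = a^r >, with named generators.
   The library's [G \isog Grp (a : x : ...)] does not name the generators and
   tests the universal property on finite groups only; here [T] ranges over all
   groups. *)
Definition Cgroup_presentation (m l r : nat) (gT : finGroupType)
    (G : {group gT}) (a x : gT) : Prop :=
  [/\ G = <<[set a; x]>> :> {set gT},
      Cgroup_rels m l r a x
    & forall (T : groupType) (b y : T), Cgroup_rels m l r b y ->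
        exists f : gT -> T,
          [/\ {in G &, {morph f : u v / u * v}}, f a = b & f x = y]].

(* k = ord(r mod m); for m = 1 every congruence holds, so k = 1. *)
Definition is_ord_mod (r m k : nat) : Prop :=
  [/\ (0 < k)%N, (r ^ k = 1 %[mod m])%N
    & forall j : nat, (0 < j)%N -> (r ^ j = 1 %[mod m])%N -> (k <= j)%N].

(* Main.v *)
Require Import Defs.
From mathcomp Require Import cyclic sylow.

(** Write [A = <a>] and [X = <x>].  The relations give [G = A * X] with [A]
normalised by [X], and the gcd hypothesis makes the orders of [a] and [x]
coprime.  Hence [A] and [X] are complementary Hall subgroups of [G], and every
normal subgroup splits as [N = (A :&: N) * (X :&: N)]
([coprime_mulG_setI_norm]).  Both factors are subgroups of cyclic groups, say
[<a ^+ m1>] and [<x ^+ l1>], where [m1] divides the order of [a].  Since [N] is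
normal it contains the commutator of [x ^+ l1] with [a], which is
[a ^+ (r ^ l1) * a^-1]; as this lies in [A :&: N = <a ^+ m1>], the congruence
[r ^ l1 = 1] holds modulo [m1].  So every normal subgroup, also one satisfying
(i) or (ii), has the form (iii), with [s = r ^ l1 - 1].

Conversely, subgroups of the normal cyclic group [A] are characteristic in it;
[x ^+ k] is central because [a ^+ (r ^ k) = a]; and in case (iii) the commutator
computed above lies in [<a ^+ m1>], so that [a] normalises [N], while [x]
obviously does. *)

Local Open Scope group_scope.

Section Cyclic.
Set Implicit Arguments.
Unset Strict Implicit.

Variable gT : finGroupType.
Implicit Types (a x y : gT) (H : {group gT}).

Lemma cycle_expg_gcd a n : <[a ^+ n]> = <[a ^+ gcdn n #[a]]>.
Proof.
apply/eqP; rewrite (eq_subG_cyclic (cycle_cyclic a)) ?cycleX //.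
apply/eqP; rewrite -!orderE !orderXgcd (gcdnC n).
by rewrite (gcdn_idPr (dvdn_gcdl _ _)).
Qed.

(** Taking the gcd with the order of [a] accounts for an exponent [n] that does
not divide that order. *)
Lemma expg_coset_cycle a n i j :
  (a ^+ i * a ^- j \in <[a ^+ n]>) = (i == j %[mod gcdn n #[a]]).
Proof.
rewrite cycle_expg_gcd; set g := gcdn n #[a].
apply/idP/eqP => [/cycleP[t] | eq_ij].
  move/(canRL (mulgKV _)); rewrite -expgM -expgD => /eqP.
  rewrite eq_expg_mod_order => /eqP/(congr1 (modn^~ g)).
  by rewrite !modn_dvdm ?dvdn_gcdr // mulnC modnMDl.
rewrite {1}(divn_eq j g) {1}(divn_eq i g) eq_ij !expgD invMg mulgA mulgK.
by rewrite !(mulnC _ g) !expgM groupM ?groupV ?mem_cycle.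
Qed.

Lemma subgroup_cycleP a H :
  H \subset <[a]> -> exists n, [/\ 0 < n, n %| #[a] & H = <[a ^+ n]> :> {set gT}].
Proof.
move=> sHa; have dvdH : #|H| %| #[a] by exact: cardSg.
exists (#[a] %/ #|H|); split.
- by rewrite divn_gt0 ?cardG_gt0 // dvdn_leq.
- by rewrite -{2}(divnK dvdH) dvdn_mulr.
have: H \in [set K : {group gT} | K \subset <[a]> & #|K| == #|H|].
  by rewrite inE sHa eqxx.
by rewrite cycle_sub_group // inE => /eqP/(congr1 val).
Qed.

Lemma conjg_expg_expg a y r n : a ^ y = a ^+ r -> a ^ (y ^+ n) = a ^+ (r ^ n).
Proof.
move=> ay; elim: n => [|n IHn]; first by rewrite conjg1.
by rewrite expgSr conjgM IHn conjXg ay -expgM expnS.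
Qed.

End Cyclic.

Section PowerAction.
Set Implicit Arguments.
Unset Strict Implicit.

Variables (gT : finGroupType) (a x : gT) (r : nat).
Hypothesis xax : x * a * x^-1 = a ^+ r.

Lemma expg_conj_power n : x ^+ n * a * x ^- n = a ^+ (r ^ n).
Proof.
have <- : a ^ (x^-1 ^+ n) = a ^+ (r ^ n).
  by apply: conjg_expg_expg; rewrite /conjg invgK mulgA.
by rewrite expgVn /conjg invgK mulgA.
Qed.

Lemma cycle_norm_cycle : <[x]> \subset 'N(<[a]>).
Proof.
by rewrite cycle_subG -groupV -cycle_subG norms_cycle /conjg invgK mulgA xax
           mem_cycle.
Qed.

(** Every subgroup of the normal cyclic group [<a>] is characteristic in it. *)
Lemma sub_cycle_normal (H : {group gT}) : H \subset <[a]> -> H <| <<[set a; x]>>.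
Proof.
move=> sHa; have chH : H \char <[a]> by rewrite sub_cyclic_char ?cycle_cyclic.
apply: char_normal_trans chH _; rewrite /normal cycle_subG mem_gen ?set21 //=.
rewrite gen_subG subUset !sub1set (subsetP (normG _)) ?cycle_id //=.
by rewrite (subsetP cycle_norm_cycle) ?cycle_id.
Qed.

Lemma gen2_mulG : <[a]> * <[x]> = <<[set a; x]>>.
Proof. by rewrite -norm_joinEr ?cycle_norm_cycle // joing_idl joing_idr. Qed.

(** The commutator equals [a ^+ (r ^ n) * a^-1], so this is
[expg_coset_cycle]. *)
Lemma commutator_expg_cycle n g :
  (r ^ n = 1 %[mod gcdn g #[a]])%N <->
  x ^+ n * a * x ^- n * a^-1 \in <[a ^+ g]>.
Proof.
by rewrite expg_conj_power -[a^-1]/(a ^- 1) expg_coset_cycle; split=> /eqP.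
Qed.

(** The congruence says that [x ^+ k] is central. *)
Lemma sub_cycle_central_normal k (H : {group gT}) :
  (r ^ k = 1 %[mod #[a]])%N -> H \subset <[x ^+ k]> -> H <| <<[set a; x]>>.
Proof.
move=> rk sHxk; have cax : commute (x ^+ k) a.
  apply: (canRL (mulgKV _)); rewrite expg_conj_power.
  by apply/eqP; rewrite -[a in _ == a]expg1 eq_expg_mod_order; apply/eqP.
rewrite /normal (subset_trans sHxk) /=; last first.
  by rewrite cycle_subG groupX // mem_gen // set22.
apply/cents_norm/(subset_trans _ (centS sHxk)).
rewrite cent_cycle gen_subG subUset !sub1set.
by apply/andP; split; apply/cent1P; [exact: commute_sym | exact: commuteX].
Qed.

(** Both generators fix [<a ^+ m1>]; [x] fixes [x ^+ l1], and [a] moves it by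
a commutator that the congruence puts in [<a ^+ m1>]. *)
Lemma cycle_mul_normal m1 l1 (N : {group gT}) :
  <[a ^+ m1]> * <[x ^+ l1]> = N -> (r ^ l1 = 1 %[mod gcdn m1 #[a]])%N ->
  N <| <<[set a; x]>>.
Proof.
move=> defN /commutator_expg_cycle com.
have sAN : <[a ^+ m1]> \subset N by rewrite -defN mulG_subl.
have Nx : x ^+ l1 \in N by rewrite -cycle_subG -defN mulG_subr.
have /normalP[_ nAG] := sub_cycle_normal (cycleX a m1).
have genN : <[a ^+ m1]> <*> <[x ^+ l1]> = N by rewrite -genM_join defN genGid.
have aG : a \in <<[set a; x]>> by rewrite mem_gen ?set21.
have xG : x \in <<[set a; x]>> by rewrite mem_gen ?set22.
have normN g : g \in <<[set a; x]>> -> (x ^+ l1) ^ g \in N -> g \in 'N(N).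
  move=> gG Nxg; rewrite inE -{1}genN conjYg nAG // join_subG sAN /=.
  by rewrite -cycleJ cycle_subG.
rewrite /normal -{1}genN join_subG !cycle_subG !groupX //=.
rewrite gen_subG subUset !sub1set.
apply/andP; split; last by apply: normN => //; rewrite conjXg (conjgE x) mulKg.
rewrite -groupV; apply: normN; rewrite ?groupV // /conjg.
have -> : a^-1^-1 * (x ^+ l1 * a^-1) =
          (x ^+ l1 * a * x ^- l1 * a^-1)^-1 * x ^+ l1.
  by rewrite !invMg !invgK !mulgA mulgKV.
by rewrite groupM // groupV (subsetP sAN).
Qed.

(** Coprimality lets [N] split along [<a>] and [<x>].  The congruence comes from
the commutator of [x ^+ l1] and [a], which lies in both [N] and [<a>]. *)
Lemma normal_cycle_mul (N : {group gT}) :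
  coprime #[a] #[x] -> N <| <<[set a; x]>> ->
  exists m1 l1, [/\ 0 < m1, 0 < l1, <[a ^+ m1]> ><| <[x ^+ l1]> = N
                  & (r ^ l1 = 1 %[mod m1])%N].
Proof.
move=> co /andP[sNG nNG].
have [m1 [m1_gt0 m1a defA]] := subgroup_cycleP (subsetIl <[a]> N).
have [l1 [l1_gt0 _ defX]] := subgroup_cycleP (subsetIl <[x]> N).
have Nx : x ^+ l1 \in N by rewrite -cycle_subG -defX subsetIr.
exists m1, l1; split=> //.
  rewrite sdprodE.
  - rewrite /= -defA -defX (coprime_mulG_setI_norm gen2_mulG nNG co).
    exact/setIidPr.
  - rewrite (subset_trans (cycleX _ _)) // (subset_trans cycle_norm_cycle) //.
    by rewrite char_norms // sub_cyclic_char ?cycle_cyclic ?cycleX.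
  by apply: coprime_TIg; rewrite (coprimeSg (cycleX _ _)) // (coprimegS (cycleX _ _)).
rewrite -(gcdn_idPl m1a); apply/commutator_expg_cycle; rewrite -defA inE.
apply/andP; split.
  by rewrite expg_conj_power groupM ?groupV ?mem_cycle ?cycle_id.
rewrite -!mulgA groupM // mulgA.
have -> : a * x ^- l1 * a^-1 = (x ^- l1) ^ a^-1 by rewrite /conjg invgK mulgA.
rewrite memJ_norm ?groupV // (subsetP nNG) // mem_gen ?set21 //.
Qed.

End PowerAction.

Lemma modz_expn_subr1 (r n g : nat) :
  (r ^ n = 1 %[mod g])%N <-> (g%:Z%R %| (r%:Z ^+ n - 1)%R)%Z.
Proof.
have -> : (r%:Z ^+ n)%R = Posz (r ^ n) by rewrite -!natz GRing.natrX.
rewrite -eqz_mod_dvd -[1%R]/(Posz 1) !modz_nat.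
by split=> [-> // | /eqP[]].
Qed.

Theorem theorem3p1 (m l r k : nat) (gT : finGroupType) (G N : {group gT})
    (a x : gT) :
  (0 < m)%N -> (0 < l)%N -> (r <= m)%N ->
  (r ^ l = 1 %[mod m])%N ->
  (gcdz (l%:Z * (r%:Z - 1)) m%:Z = 1)%R ->
  Cgroup_presentation m l r G a x ->
  is_ord_mod r m k ->
  N \subset G ->
  ((N <| G)%g <->
   [\/ N \subset <[a]>%g,
       N \subset <[x ^+ k]>%g
     | exists m1 l1 : nat,
         [/\ (0 < m1)%N, (0 < l1)%N,
             (<[a ^+ m1]> ><| <[x ^+ l1]>)%g = N
           & exists s : int,
               (s = (r%:Z ^+ l1 - 1)%R %[mod m%:Z%R])%Z /\ (m1%:Z%R %| s)%Z]]).
Proof.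
move=> _ _ _ _ co_lm [-> [am xl xax] _] [_ rk _] _.
have a_m : #[a] %| m by rewrite order_dvdn am.
have x_l : #[x] %| l by rewrite order_dvdn xl.
have co : coprime #[a] #[x].
  apply: coprime_dvdl a_m _; apply: coprime_dvdr x_l _.
  have: coprimez (l%:Z * (r%:Z - 1))%R m by apply/eqP.
  by rewrite coprimezMl coprime_sym => /andP[].
split=> [nNG | [sNa | sNxk | [m1 [l1 [_ _ defN [s [s_r m1_s]]]]]]].
- have [m1 [l1 [m1_gt0 l1_gt0 defN rl1]]] := normal_cycle_mul xax co nNG.
  apply: Or33; exists m1, l1; split=> //; exists (r%:Z ^+ l1 - 1)%R; split=> //.
  exact/modz_expn_subr1.
- exact: sub_cycle_normal xax _ sNa.
- apply: sub_cycle_central_normal xax _ _ _ sNxk.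
  by rewrite -(modn_dvdm _ a_m) rk modn_dvdm.
have [_ mulN _ _] := sdprodP defN.
apply: cycle_mul_normal xax _ _ _ mulN _; apply/modz_expn_subr1.
(* [s] is known only modulo [m]; [g] divides both [m] and [m1]. *)
set g := gcdn m1 #[a].
have g_m : (g%:Z%R %| m%:Z%R)%Z by exact: dvdn_trans (dvdn_gcdr _ _) a_m.
have g_s : (g%:Z%R %| s)%Z by apply: dvdz_trans m1_s; exact: dvdn_gcdl.
have: (m%:Z%R %| (s - (r%:Z ^+ l1 - 1))%R)%Z by rewrite -eqz_mod_dvd; apply/eqP.
by move/(dvdz_trans g_m); rewrite GRing.rpredBl.
Qed.
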